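(* Let $\mathbb{K}$ be a field of characteristic $p>0$, let $R=\mathbb{K}[\![x,y,z]\!]$, let $I=(xy,yz)\subseteq R$, let $S=R/I$, and let $E_S$ be the injective hull of the residue field of $S$. Then the $S$-algebra $\mathcal{F}(E_S)=\bigoplus_{e\ge 0}\mathcal{F}^e(E_S)$ is not finitely generated.
   Context: For a commutative ring $S$ of prime characteristic $p$, an $S$-module $M$ and $e\ge 0$, $\mathcal{F}^e(M)$ denotes the set of all additive functions $\phi:M\to M$ such that $\phi(sm)=s^{p^e}\phi(m)$ for all $s\in S$, $m\in M$. If $\phi_1\in\mathcal{F}^{e_1}(M)$ and $\phi_2\in\mathcal{F}^{e_2}(M)$ then $\phi_2\circ\phi_1\in\mathcal{F}^{e_1+e_2}(M)$. The direct sum $\mathcal{F}(M)=\bigoplus_{e\ge 0}\mathcal{F}^e(M)$ is thus a graded (generally non-commutative) ring with multiplication given by composition, and is regarded as an algebra over its degree-zero part $\mathcal{F}^0(M)=\mathrm{Hom}_S(M,M)$. For $M=E_S$ with $S$ complete local, $\mathcal{F}^0(E_S)=\mathrm{Hom}_S(E_S,E_S)\cong S$ (with $S$ acting by multiplication), and in this way $\mathcal{F}(E_S)$ is an $S$-algebra; $S$ need not be central in it. It is finitely generated as an $S$-algebra if there is a finite subset $T\subseteq\mathcal{F}(E_S)$ such that the smallest subring of $\mathcal{F}(E_S)$ containing $\mathcal{F}^0(E_S)$ and $T$ is $\mathcal{F}(E_S)$. *)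

(* Defs.v *)
From HB Require Import structures.
From mathcomp Require Import all_boot all_order all_algebra.
From mathcomp Require Import ring_quotient.
From mathcomp Require Import boolp.
From mathcomp Require Import mpoly.

Set Implicit Arguments.
Unset Strict Implicit.
Unset Printing Implicit Defensive.

Import GRing.Theory.
Local Open Scope ring_scope.

(* Formal power series in n commuting variables: arbitrary families of
   coefficients indexed by the monomials 'X_{1..n}. *)
Record fps (n : nat) (R : comNzRingType) :=
  Fps { fcoef : 'X_{1..n} -> R }.

Section PowerSeries.
Variables (n : nat) (R : comNzRingType).
Implicit Types (f g h : fps n R) (m k : 'X_{1..n}).

HB.instance Definition _ := gen_eqMixin (fps n R).
HB.instance Definition _ := gen_choiceMixin (fps n R).

Lemma fpsP f g : (forall m, fcoef f m = fcoef g m) <-> f = g.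
Proof.
split=> [|-> //]; case: f => f; case: g => g /= e; congr Fps.
exact/funext.
Qed.

Definition fps_zero : fps n R := Fps (fun=> 0).
Definition fps_opp f : fps n R := Fps (fun m => - fcoef f m).
Definition fps_add f g : fps n R := Fps (fun m => fcoef f m + fcoef g m).

Fact fps_addA : associative fps_add.
Proof. by move=> f g h; apply/fpsP=> m /=; rewrite addrA. Qed.
Fact fps_addC : commutative fps_add.
Proof. by move=> f g; apply/fpsP=> m /=; rewrite addrC. Qed.
Fact fps_add0 : left_id fps_zero fps_add.
Proof. by move=> f; apply/fpsP=> m /=; rewrite add0r. Qed.
Fact fps_addN : left_inverse fps_zero fps_opp fps_add.
Proof. by move=> f; apply/fpsP=> m /=; rewrite addNr. Qed.

HB.instance Definition _ :=
  GRing.isZmodule.Build (fps n R) fps_addA fps_addC fps_add0 fps_addN.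

Definition fpsC (c : R) : fps n R :=
  Fps (fun m => if m == 0%MM then c else 0).

Definition fps_mul f g : fps n R := Fps (fun m =>
  \sum_(k : 'X_{1..n < (mdeg m).+1} | (k <= m)%MM) fcoef f k * fcoef g (m - k)%MM).

Definition fps_trunc d f : {mpoly R[n]} :=
  \sum_(m : 'X_{1..n < d}) fcoef f m *: 'X_[m].

Lemma mcoeff_fps_trunc d f m : (mdeg m < d)%N -> (fps_trunc d f)@_m = fcoef f m.
Proof.
move=> lt_md; rewrite /fps_trunc.
exact: (mcoeff_mpoly (fun m => fcoef f m) lt_md).
Qed.

Lemma mdeg_subm m k : (mdeg (m - k)%MM <= mdeg m)%N.
Proof. by rewrite !mdegE leq_sum // => i _; rewrite mnmBE leq_subr. Qed.

Lemma fps_mul_trunc d f g m : (mdeg m < d)%N ->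
  fcoef (fps_mul f g) m = (fps_trunc d f * fps_trunc d g)@_m.
Proof.
move=> lt_md; rewrite (@mcoeff_poly_mul_lin _ _ _ _ _ _ (ltnSn (mdeg m))) /=.
apply: eq_bigr => k le_km.
rewrite !mcoeff_fps_trunc //.
  by apply: leq_ltn_trans lt_md; apply: mdeg_subm.
by apply: leq_trans lt_md; apply: bmdeg.
Qed.

Lemma mcoeffM_low d (p p' q q' : {mpoly R[n]}) m : (mdeg m < d)%N ->
  (forall k, (mdeg k < d)%N -> p@_k = p'@_k) ->
  (forall k, (mdeg k < d)%N -> q@_k = q'@_k) ->
  (p * q)@_m = (p' * q')@_m.
Proof.
move=> lt_md ep eq; rewrite !(@mcoeff_poly_mul_lin _ _ _ _ _ _ (ltnSn (mdeg m))).
apply: eq_bigr => k le_km; rewrite ep ?eq //.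
  by apply: leq_ltn_trans lt_md; apply: mdeg_subm.
by apply: leq_trans lt_md; apply: bmdeg.
Qed.

Fact fps_mulA : associative fps_mul.
Proof.
move=> f g h; apply/fpsP=> m; set d := (mdeg m).+1.
have tM f1 f2 k : (mdeg k < d)%N ->
    (fps_trunc d (fps_mul f1 f2))@_k = (fps_trunc d f1 * fps_trunc d f2)@_k.
  by move=> lt_kd; rewrite mcoeff_fps_trunc // (fps_mul_trunc _ _ lt_kd).
rewrite !(@fps_mul_trunc d) //.
rewrite (mcoeffM_low (ltnSn _) (fun _ _ => erefl) (tM g h)) mulrA.
by rewrite -(mcoeffM_low (ltnSn _) (tM f g) (fun _ _ => erefl)).
Qed.

Fact fps_mulC : commutative fps_mul.
Proof.
by move=> f g; apply/fpsP=> m; rewrite !(fps_mul_trunc _ _ (ltnSn _)) mulrC.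
Qed.

Lemma fps_mulCE c f m : fcoef (fps_mul (fpsC c) f) m = c * fcoef f m.
Proof.
rewrite (fps_mul_trunc _ _ (ltnSn _)).
rewrite (@mcoeffM_low (mdeg m).+1 _ c%:MP _ (fps_trunc (mdeg m).+1 f)) //.
  by rewrite mcoeffCM mcoeff_fps_trunc.
move=> k lt_k; rewrite mcoeff_fps_trunc //= mcoeffC.
by case: eqP; rewrite ?mulr1 ?mulr0.
Qed.

Fact fps_mul1 : left_id (fpsC 1) fps_mul.
Proof. by move=> f; apply/fpsP=> m; rewrite fps_mulCE mul1r. Qed.

Fact fps_mulDl : left_distributive fps_mul +%R.
Proof.
move=> f g h; apply/fpsP=> m /=; rewrite -big_split /=.
by apply: eq_bigr => k _; rewrite mulrDl.
Qed.

Fact fps_1neq0 : fpsC 1 != 0.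
Proof.
apply/eqP => /fpsP/(_ 0%MM) /=; rewrite eqxx => /eqP.
by rewrite oner_eq0.
Qed.

HB.instance Definition _ := GRing.Zmodule_isComNzRing.Build (fps n R)
  fps_mulA fps_mulC fps_mul1 fps_mulDl fps_1neq0.

Definition fpsX (i : 'I_n) : fps n R := Fps (fun m => (m == U_(i)%MM)%:R).

Lemma fcoef0 m : fcoef (0 : fps n R) m = 0. Proof. by []. Qed.
Lemma fcoef1 m : fcoef (1 : fps n R) m = (m == 0%MM)%:R.
Proof. by rewrite /=; case: eqP. Qed.
Lemma fcoefD f g m : fcoef (f + g) m = fcoef f m + fcoef g m.
Proof. by []. Qed.
Lemma fcoefN f m : fcoef (- f) m = - fcoef f m. Proof. by []. Qed.
Lemma fcoefM f g m : fcoef (f * g) m =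
  \sum_(k : 'X_{1..n < (mdeg m).+1} | (k <= m)%MM) fcoef f k * fcoef g (m - k)%MM.
Proof. by []. Qed.
Lemma fcoef_sum I (r : seq I) (P : pred I) (F : I -> fps n R) m :
  fcoef (\sum_(i <- r | P i) F i) m = \sum_(i <- r | P i) fcoef (F i) m.
Proof. exact: (big_morph (fun f => fcoef f m) (fun f g => fcoefD f g m)). Qed.

Lemma fcoefM0 f g : fcoef (f * g) 0%MM = fcoef f 0%MM * fcoef g 0%MM.
Proof.
have h d : (mdeg (0%MM : 'X_{1..n}) < d.+1)%N by rewrite mdeg0.
rewrite (@fps_mul_trunc 1) // mcoeffM.
rewrite (bigD1 (BMultinom (h _), BMultinom (h _))) /=; last by rewrite addm0.
rewrite !mcoeff_fps_trunc ?mdeg0 // big1 ?addr0 // => -[[a ha] [b hb]] /=.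
case/andP=> /eqP e /negP[]; apply/eqP; congr pair; apply/val_inj => /=.
  by move/esym/eqP: e; rewrite mnmD_eq0 => /andP[/eqP].
by move/esym/eqP: e; rewrite mnmD_eq0 => /andP[_ /eqP].
Qed.

End PowerSeries.

Lemma fps_expr_low n (R : comNzRingType) (g : fps n R) : fcoef g 0%MM = 0 ->
  forall i m, (mdeg m < i)%N -> fcoef (g ^+ i) m = 0.
Proof.
move=> g0; elim=> // i IH m lt_mi; rewrite exprS fcoefM big1 // => -[k _] /= le_km.
have [k0|nk0] := eqVneq k 0%MM; first by rewrite k0 g0 mul0r.
rewrite IH ?mulr0 //.
have e : mdeg m = (mdeg (m - k)%MM + mdeg k)%N by rewrite -mdegD submK.
have k_gt0 : (0 < mdeg k)%N by rewrite lt0n mdeg_eq0.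
rewrite -ltnS (leq_trans _ lt_mi) // e ltnS -addn1 leq_add2l.
exact: k_gt0.
Qed.

Lemma fps_inv_ex n (K : fieldType) (f : fps n K) :
  fcoef f 0%MM != 0 -> exists h : fps n K, h * f = 1.
Proof.
set c := fcoef f _ => nc; pose g : fps n K := 1 - fpsC n c^-1 * f.
have g0 : fcoef g 0%MM = 0.
  by rewrite fcoefD fcoefN fcoef1 eqxx fps_mulCE mulVf // subrr.
pose P d : fps n K := \sum_(i < d) g ^+ i.
pose Q : fps n K := Fps (fun m => fcoef (P (mdeg m).+1) m).
have QE d m : (mdeg m < d)%N -> fcoef Q m = fcoef (P d) m.
  move=> lt_md; rewrite /= /P !fcoef_sum -(subnKC lt_md) big_split_ord /=.
  rewrite [X in _ + X]big1 ?addr0 // => i _.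
  by rewrite (fps_expr_low g0) // addSn ltnS leq_addr.
have PE d : (1 - g) * P d = 1 - g ^+ d.
  by rewrite /P -opprB mulNr -subrX1 opprB.
exists (fpsC n c^-1 * Q).
rewrite mulrAC; have -> : fpsC n c^-1 * f = 1 - g by rewrite /g subKr.
apply/fpsP => m.
transitivity (fcoef ((1 - g) * P (mdeg m).+1) m).
  rewrite !fcoefM; apply: eq_bigr => k le_km; congr (_ * _).
  by apply: QE; rewrite ltnS mdeg_subm.
by rewrite PE fcoefD fcoefN (fps_expr_low g0) // subr0.
Qed.

Section QuotientModule.
Variables (R : comNzRingType) (I : idealr R).
Local Notation Q := {ideal_quot I}.

Definition quot_scale (a : R) (u : Q) : Q := \pi_Q%qT a * u.

Fact quot_scaleA a b u : quot_scale a (quot_scale b u) = quot_scale (a * b) u.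
Proof. by rewrite /quot_scale mulrA rmorphM. Qed.
Fact quot_scale1 : left_id 1 quot_scale.
Proof. by move=> u; rewrite /quot_scale rmorph1 mul1r. Qed.
Fact quot_scaleDr : right_distributive quot_scale +%R.
Proof. by move=> a u v; rewrite /quot_scale mulrDr. Qed.
Fact quot_scaleDl u : {morph quot_scale^~ u : a b / a + b}.
Proof. by move=> a b; rewrite /quot_scale rmorphD mulrDl. Qed.

HB.instance Definition _ := GRing.Zmodule_isLmodule.Build R Q
  quot_scaleA quot_scale1 quot_scaleDr quot_scaleDl.
End QuotientModule.

Definition nonunits (S : comNzRingType) : {pred S} :=
  fun s => ~~ `[< exists t : S, t * s = 1 >].
Arguments nonunits : clear implicits.

Definition injective_module (S : comNzRingType) (E : lmodType S) : Prop :=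
  forall (A B : lmodType S) (f : {linear A -> B}) (g : {linear A -> E}),
    injective f -> exists h : {linear B -> E}, forall a, h (f a) = g a.

Definition essential (S : comNzRingType) (M E : lmodType S)
    (i : {linear M -> E}) : Prop :=
  forall N : {pred E}, submod_closed N ->
    (exists2 x, x \in N & x != 0) -> exists2 m : M, i m \in N & i m != 0.

Definition injective_hull (S : comNzRingType) (M E : lmodType S)
    (i : {linear M -> E}) : Prop :=
  [/\ injective i, essential i & injective_module E].

Section FrobeniusAlgebra.
Variables (p : nat) (S : comNzRingType) (M : lmodType S).

Definition is_frob (e : nat) (phi : M -> M) : Prop :=
  zmod_morphism phi /\ forall (s : S) (x : M), phi (s *: x) = s ^+ (p ^ e) *: phi x.

(* An element of the direct sum of the F^e(M): a family (phi_e)_e with phi_e in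
   F^e(M) and phi_e = 0 for all large e. *)
Record frobAlg := FrobAlg {
  fhom : nat -> M -> M;
  fhomP : forall e, is_frob e (fhom e);
  fhom_fin : exists d, forall e, (d <= e)%N -> forall x, fhom e x = 0 }.

Implicit Types (phi psi chi : frobAlg).

Lemma frobP phi psi : (forall e x, fhom phi e x = fhom psi e x) <-> phi = psi.
Proof.
split=> [|-> //]; case: phi => f hf nf; case: psi => g hg ng /= fg.
have {}fg : f = g by apply/funext => e; apply/funext => x.
by case: g / fg hg ng => hg ng; congr FrobAlg; apply: Prop_irrelevance.
Qed.

HB.instance Definition _ := gen_eqMixin frobAlg.
HB.instance Definition _ := gen_choiceMixin frobAlg.

Lemma frobB phi e x y : fhom phi e (x - y) = fhom phi e x - fhom phi e y.
Proof. by case: (fhomP phi e) => h _; apply: h. Qed.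
Lemma frobZ phi e s x : fhom phi e (s *: x) = s ^+ (p ^ e) *: fhom phi e x.
Proof. by case: (fhomP phi e) => _; apply. Qed.

HB.instance Definition _ phi e :=
  GRing.isZmodMorphism.Build M M (fhom phi e) (fhomP phi e).1.

Fact frob_zeroP : forall e, is_frob e (fun _ => 0).
Proof. by move=> e; split=> [x y|s x]; rewrite ?subr0 ?scaler0. Qed.
Fact frob_zero_fin : exists d, forall e, (d <= e)%N -> forall x : M, 0 = 0 :> M.
Proof. by exists 0%N. Qed.
Definition frob_zero := FrobAlg frob_zeroP frob_zero_fin.

Fact frob_oppP phi : forall e, is_frob e (fun x => - fhom phi e x).
Proof.
move=> e; split=> [x y|s x]; first by rewrite raddfB opprD.
by rewrite frobZ scalerN.
Qed.
Fact frob_opp_fin phi :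
  exists d, forall e, (d <= e)%N -> forall x, - fhom phi e x = 0.
Proof. by have [d h] := fhom_fin phi; exists d => e le x; rewrite h ?oppr0. Qed.
Definition frob_opp phi := FrobAlg (frob_oppP phi) (frob_opp_fin phi).

Fact frob_addP phi psi : forall e, is_frob e (fun x => fhom phi e x + fhom psi e x).
Proof.
move=> e; split=> [x y|s x]; first by rewrite !raddfB opprD addrACA.
by rewrite !frobZ scalerDr.
Qed.
Fact frob_add_fin phi psi : exists d, forall e, (d <= e)%N ->
  forall x, fhom phi e x + fhom psi e x = 0.
Proof.
have [d h] := fhom_fin phi; have [d' h'] := fhom_fin psi.
by exists (maxn d d') => e; rewrite geq_max => /andP[? ?] x; rewrite h ?h' ?addr0.
Qed.
Definition frob_add phi psi := FrobAlg (frob_addP phi psi) (frob_add_fin phi psi).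

Fact frob_addA : associative frob_add.
Proof. by move=> f g h; apply/frobP=> e x /=; rewrite addrA. Qed.
Fact frob_addC : commutative frob_add.
Proof. by move=> f g; apply/frobP=> e x /=; rewrite addrC. Qed.
Fact frob_add0 : left_id frob_zero frob_add.
Proof. by move=> f; apply/frobP=> e x /=; rewrite add0r. Qed.
Fact frob_addN : left_inverse frob_zero frob_opp frob_add.
Proof. by move=> f; apply/frobP=> e x /=; rewrite addNr. Qed.

HB.instance Definition _ :=
  GRing.isZmodule.Build frobAlg frob_addA frob_addC frob_add0 frob_addN.

Fact frob_oneP : forall e, is_frob e (fun x : M => if e == 0%N then x else 0).
Proof.
by case=> [|e]; split=> [x y|s x] //=; rewrite ?subr0 ?scaler0 ?expr1.
Qed.
Fact frob_one_fin : exists d, forall e, (d <= e)%N ->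
  forall x : M, (if e == 0%N then x else 0) = 0.
Proof. by exists 1%N; case. Qed.
Definition frob_one := FrobAlg frob_oneP frob_one_fin.

(* Biadditive extension of composition: phi in degree d times psi in degree e is
   phi \o psi in degree d + e. *)
Fact frob_mulP phi psi : forall e, is_frob e
  (fun x => \sum_(i < e.+1) fhom phi i (fhom psi (e - i)%N x)).
Proof.
move=> e; split=> [x y|s x].
  by rewrite -sumrB; apply: eq_bigr => i _; rewrite !raddfB.
rewrite scaler_sumr; apply: eq_bigr => i _.
by rewrite !frobZ -exprM -expnD subnK // -ltnS.
Qed.
Fact frob_mul_fin phi psi : exists d, forall e, (d <= e)%N ->
  forall x, \sum_(i < e.+1) fhom phi i (fhom psi (e - i)%N x) = 0.
Proof.
have [d h] := fhom_fin phi; have [d' h'] := fhom_fin psi.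
exists (d + d')%N => e le x; apply: big1 => i _.
have [le_di|lt_id] := leqP d i; first by rewrite h.
by rewrite h' ?raddf0 // leq_subRL ?(leq_trans _ le) ?leq_add2r ?(ltnW lt_id)//
   (leq_trans (ltnW lt_id)) ?leq_addr.
Qed.
Definition frob_mul phi psi := FrobAlg (frob_mulP phi psi) (frob_mul_fin phi psi).

Fact frob_mulA : associative frob_mul.
Proof.
move=> f g h; apply/frobP => e x /=.
pose t j k := fhom f j (fhom g (e - j - k)%N (fhom h k x)).
transitivity (\sum_(j < e.+1) \sum_(k < e.+1 | (k <= e - j)%N) t j k).
  apply: eq_bigr => /= j _; rewrite raddf_sum /=.
  rewrite (big_ord_narrow_leq (leq_subr _ _)) /= (reindex_inj rev_ord_inj) /=.
  by apply: eq_bigr => k _; rewrite /t !subSS (subKn (leq_ord k)).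
rewrite (exchange_big_dep predT) //= [RHS](reindex_inj rev_ord_inj) /=.
apply: eq_bigr => k _.
transitivity (\sum_(j < e.+1 | (j <= e - k)%N) t j k).
  apply: eq_bigl => j; rewrite -ltnS -(ltnS j) -!subSn ?leq_ord //.
  by rewrite -subn_gt0 -(subn_gt0 j) -!subnDA addnC.
rewrite (big_ord_narrow_leq (leq_subr _ _)) /= !subSS (subKn (leq_ord k)).
by apply: eq_bigr => j _; rewrite /t -!subnDA addnC.
Qed.

Fact frob_mul1l : left_id frob_one frob_mul.
Proof.
move=> f; apply/frobP => e x /=; rewrite big_ord_recl /= subn0 big1 ?addr0 //.
Qed.
Fact frob_mul1r : right_id frob_one frob_mul.
Proof.
move=> f; apply/frobP => e x /=; rewrite big_ord_recr /= subnn eqxx.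
rewrite big1 ?add0r // => i _ /=; rewrite ifF ?raddf0 //.
by apply/negbTE; rewrite -lt0n subn_gt0.
Qed.
Fact frob_mulDl : left_distributive frob_mul +%R.
Proof.
by move=> f g h; apply/frobP => e x /=; rewrite -big_split; apply: eq_bigr.
Qed.
Fact frob_mulDr : right_distributive frob_mul +%R.
Proof.
move=> f g h; apply/frobP => e x /=; rewrite -big_split; apply: eq_bigr => i _.
by rewrite /= raddfD.
Qed.

HB.instance Definition _ := GRing.Zmodule_isPzRing.Build frobAlg
  frob_mulA frob_mul1l frob_mul1r frob_mulDl frob_mulDr.

Definition frob_deg0 : {pred frobAlg} :=
  fun phi => `[< forall e x, (0 < e)%N -> fhom phi e x = 0 >].

(* The only subring containing the degree-zero part and the finite set T is
   the whole ring, i.e. the smallest such subring is the whole ring. *)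
Definition frob_fingen : Prop :=
  exists T : seq frobAlg, forall A : {pred frobAlg},
    subring_closed A -> {subset frob_deg0 <= A} -> {subset T <= A} ->
    forall phi, phi \in A.

End FrobeniusAlgebra.

Section TheRing.
Variable K : fieldType.

Definition Rxyz := fps 3 K.
HB.instance Definition _ := GRing.ComNzRing.on Rxyz.

Definition xR : Rxyz := fpsX K (inord 0 : 'I_3).
Definition yR : Rxyz := fpsX K (inord 1 : 'I_3).
Definition zR : Rxyz := fpsX K (inord 2 : 'I_3).

Definition Ixyz : {pred Rxyz} :=
  fun f => `[< exists a b : Rxyz, f = a * (xR * yR) + b * (yR * zR) >].

Lemma Ixyz_coef0 f : f \in Ixyz -> fcoef f 0%MM = 0.
Proof.
have X0 (i : 'I_3) : fcoef (fpsX K i) 0%MM = 0.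
  by rewrite /= eq_sym mnm1_eq0.
move=> /asboolP[a [b ->]].
by rewrite fcoefD !fcoefM0 !X0 !(mulr0, mul0r) addr0.
Qed.

Fact Ixyz_idealr : idealr_closed Ixyz.
Proof.
split.
- by apply/asboolP; exists 0, 0; rewrite !mul0r addr0.
- by apply/negP => /Ixyz_coef0; rewrite fcoef1 eqxx => /eqP; rewrite oner_eq0.
- move=> c f g /asboolP[a [b ->]] /asboolP[a' [b' ->]]; apply/asboolP.
  exists (c * a + a'), (c * b + b').
  by rewrite mulrDr !mulrDl !mulrA addrACA.
Qed.
HB.instance Definition _ := isIdealr.Build Rxyz Ixyz Ixyz_idealr.

Definition Sxyz := {ideal_quot Ixyz}.
HB.instance Definition _ := GRing.ComNzRing.on Sxyz.

Lemma Sxyz_nonunitE (f : Rxyz) :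
  (\pi_Sxyz%qT f \in nonunits Sxyz) = (fcoef f 0%MM == 0).
Proof.
apply/idP/idP => [|/eqP f0].
  apply: contraNT => /fps_inv_ex[h hf]; apply/asboolP.
  by exists (\pi_Sxyz%qT h); rewrite -rmorphM hf rmorph1.
apply/negP => /asboolP[t]; rewrite -[t]reprK -rmorphM => tf.
have : repr t * f - 1 \in Ixyz.
  by rewrite Quotient.idealrBE; apply/eqP; rewrite tf rmorph1.
move=> /Ixyz_coef0; rewrite fcoefD fcoefN fcoefM0 f0 mulr0 fcoef1 eqxx add0r.
by move/eqP; rewrite oppr_eq0 oner_eq0.
Qed.

(* Sxyz is local (mS_idealr below), so its maximal ideal is the set of nonunits. *)
Definition mS : {pred Sxyz} := nonunits Sxyz.

Fact mS_idealr : idealr_closed mS.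
Proof.
split.
- by rewrite -[0](rmorph0 \pi_Sxyz%qT) Sxyz_nonunitE.
- by rewrite -[1](rmorph1 \pi_Sxyz%qT) Sxyz_nonunitE fcoef1 eqxx oner_eq0.
- move=> c u v; rewrite -[c]reprK -[u]reprK -[v]reprK -rmorphM -rmorphD.
  rewrite !Sxyz_nonunitE fcoefD fcoefM0 => /eqP-> /eqP->.
  by rewrite mulr0 addr0.
Qed.
HB.instance Definition _ := isIdealr.Build Sxyz mS mS_idealr.

(* The residue field, with the Sxyz-module structure a *: u = \pi a * u. *)
Definition kS := {ideal_quot mS}.
HB.instance Definition _ := GRing.ComNzRing.on kS.
HB.instance Definition _ := GRing.Lmodule.on kS.
End TheRing.

(* Main.v *)
(* Write q = p^e and E = E_S. A p^e-linear phi : E -> E is "decomposable" when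
   (xz)^(q-1) phi(v) = 0 for every v killed by x^2, y and z.

   Decomposability is stable under composition with S-linear maps, and a composite
   of two Frobenius maps of positive degrees is always decomposable: every socle
   element s is y t for some t, so phi(s) = y^q phi(t) is killed by z because
   yz = 0. Hence if the algebra were generated in degrees < d, then every element
   would be decomposable in degree d.

   On the other hand an indecomposable map exists in every positive degree.
   Injectivity yields u_n in E (the inverse monomials x^-n z^-n) with u_0 a socle
   generator, xz u_(n+1) = u_n, and annihilator (y, x^(n+1), z^(n+1)). Since
   K[[x,z]] is Noetherian, the elements of E killed by y are torsion for x and z,
   so they are multiples of some u_n, and s u_n |-> s^q u_(q(n+1)-1) is a
   well-defined Frobenius map on them; precomposing it with multiplication by x
   gives the wanted map, as seen on v = z u_1. *)

Require Import Defs.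
From HB Require Import structures.
From mathcomp Require Import all_boot all_order all_algebra.
From mathcomp Require Import ring_quotient boolp mpoly zify ring.

Set Implicit Arguments.
Unset Strict Implicit.
Unset Printing Implicit Defensive.

Import GRing.Theory.
Local Open Scope ring_scope.

(** * Division of power series *)

Section PowerSeriesDivision.
Variables (n : nat) (R : comNzRingType).
Implicit Types (f g : fps n R) (m : 'X_{1..n}) (i : 'I_n).

Lemma fcoefXM i f m :
  fcoef (fpsX R i * f) m = if m i == 0%N then 0 else fcoef f (m - U_(i))%MM.
Proof.
rewrite fcoefM; case: ifPn => [/eqP mi0|mi0].
  apply: big1 => -[k /= hk] le_km; case: eqP => [ek|]; last by rewrite mul0r.
  by have /mnm_lepP/(_ i) := le_km; rewrite ek mnm1E eqxx mi0.
have hU : (mdeg U_(i) < (mdeg m).+1)%N.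
  rewrite mdeg1 ltnS lt0n mdeg_eq0; apply: contra mi0 => /eqP ->.
  by rewrite mnm0E.
rewrite (bigD1 (BMultinom hU)) /= ?lep1mP // eqxx mul1r big1 ?addr0 //.
move=> -[k /= hk] /andP[_ /eqP ne]; case: eqP => [ek|]; last by rewrite mul0r.
by case: ne; apply: val_inj.
Qed.

Lemma fcoefXnM i a f m : fcoef (fpsX R i ^+ a * f) m =
  if (m i < a)%N then 0 else fcoef f (m - U_(i) *+ a)%MM.
Proof.
elim: a m => [|a IH] m.
  by rewrite expr0 mul1r mulm0n subm0.
rewrite exprS -mulrA fcoefXM IH mnmBE mnm1E eqxx.
case: eqP => [->//|/eqP mi0]; rewrite -(ltn_add2r 1) subnK ?lt0n // addn1.
case: ifP => // _; congr fcoef; apply/mnmP => j.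
by rewrite !mnmBE !mulmnE mulnS subnDA.
Qed.

Definition fps_shift i a f : fps n R := Fps (fun m => fcoef f (m + U_(i) *+ a)%MM).

Lemma fps_divXn i a f : (forall m, (m i < a)%N -> fcoef f m = 0) ->
  f = fpsX R i ^+ a * fps_shift i a f.
Proof.
move=> f0; apply/fpsP => m; rewrite fcoefXnM; case: ltnP => [/f0//|le_am] /=.
congr fcoef; apply/mnmP => j; rewrite mnmDE mnmBE mulmnE mnm1E.
by case: eqP => [<-|_]; rewrite ?mul0n ?mul1n ?subn0 ?addn0 // subnK.
Qed.

Lemma fpsXn_lreg i a : GRing.lreg (fpsX R i ^+ a).
Proof.
move=> f g /fpsP fg; apply/fpsP => m.
have := fg (m + U_(i) *+ a)%MM; rewrite !fcoefXnM mnmDE mulmnE mnm1E eqxx.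
by rewrite mul1n ltnNge leq_addl /= addmK.
Qed.

Definition fps_res (P : pred 'X_{1..n}) f : fps n R :=
  Fps (fun m => if P m then fcoef f m else 0).

Lemma fps_resD P f : f = fps_res P f + fps_res (predC P) f.
Proof. by apply/fpsP => m; rewrite fcoefD /=; case: (P m); rewrite ?addr0 ?add0r. Qed.

Lemma fps_cap_Xn i f : (forall N, exists h, f = fpsX R i ^+ N * h) -> f = 0.
Proof.
move=> fh; apply/fpsP => m; have [h ->] := fh (m i).+1.
by rewrite fcoefXnM ltnSn.
Qed.

(* The X_i-adically convergent series \sum_k X_i^k * c_k. *)
Definition fps_series i (c : nat -> fps n R) : fps n R :=
  Fps (fun m => \sum_(k < (m i).+1) fcoef (c k) (m - U_(i) *+ k)%MM).

Lemma fps_seriesS i c :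
  fps_series i c = c 0%N + fpsX R i * fps_series i (fun k => c k.+1).
Proof.
apply/fpsP => m; rewrite fcoefD fcoefXM /= big_ord_recl mulm0n subm0.
congr (_ + _); case: ifPn => [/eqP->|mi0]; first by rewrite big_ord0.
rewrite mnmBE mnm1E eqxx subn1 prednK ?lt0n //; apply: eq_bigr => k _.
congr fcoef; apply/mnmP => j; rewrite !mnmBE !mulmnE /= /bump leq0n add1n.
by rewrite mulnS subnDA.
Qed.

(** Unrolling the recurrence leaves [w] times the series of the [c k], plus [y] times the series of
    the [b k], plus a remainder divisible by every power of [X_i], hence zero. *)
Lemma fps_division i w y (g c b : nat -> fps n R) :
  (forall k, g k = w * c k + y * b k + fpsX R i * g k.+1) ->
  exists c' b', g 0%N = w * c' + y * b'.
Proof.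
move=> gE; exists (fps_series i c), (fps_series i b).
apply/eqP; rewrite -subr_eq0; apply/eqP/(@fps_cap_Xn i) => N.
elim: N g c b gE => [|N IH] g c b gE.
  by eexists; rewrite expr0 mul1r.
have [h hE] := IH _ _ _ (fun k => gE k.+1).
exists h; rewrite exprS -mulrA -hE (gE 0%N) (fps_seriesS i c) (fps_seriesS i b).
have telescope (A : comPzRingType) (t w0 y0 c0 c1 b0 b1 g1 : A) :
    w0 * c0 + y0 * b0 + t * g1 - (w0 * (c0 + t * c1) + y0 * (b0 + t * b1)) =
    t * (g1 - (w0 * c1 + y0 * b1)) by ring.
exact: telescope.
Qed.

End PowerSeriesDivision.

(** * Monomial decompositions in three variables *)

Section ThreeVariables.
Variable K : fieldType.
Local Notation R := (Rxyz K).
Local Notation x := (xR K).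
Local Notation y := (yR K).
Local Notation z := (zR K).
Local Notation ix := (inord 0 : 'I_3).
Local Notation iy := (inord 1 : 'I_3).
Local Notation iz := (inord 2 : 'I_3).
Implicit Types (f g : R) (m : 'X_{1..3}).

Lemma ord3_neq :
  ((ix == iy) = false) * ((ix == iz) = false) * ((iy == iz) = false) *
  ((iy == ix) = false) * ((iz == ix) = false) * ((iz == iy) = false).
Proof. by do ![split]; apply/eqP => /(congr1 val); rewrite /= !inordK. Qed.

Lemma ord3P (P : 'I_3 -> Prop) : P ix -> P iy -> P iz -> forall i, P i.
Proof.
move=> Px Py Pz i; rewrite -(inord_val i).
by case: i => -[|[|[|]]].
Qed.

(** A monomial outside the box [x^i z^j], [i < a], [j < c], is divisible by [y], [x^a] or [z^c]; the
    series is split along the first of these that applies. *)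
Lemma box_decomp a c f :
  (forall m, m iy = 0%N -> (m ix < a)%N -> (m iz < c)%N -> fcoef f m = 0) ->
  exists u v w, f = y * u + x ^+ a * v + z ^+ c * w.
Proof.
move=> f0.
set fy := fps_res (fun m => (0 < m iy)%N) f.
set g := fps_res (predC (fun m => (0 < m iy)%N)) f.
set gx := fps_res (fun m => (a <= m ix)%N) g.
set gz := fps_res (predC (fun m => (a <= m ix)%N)) g.
exists (fps_shift iy 1 fy), (fps_shift ix a gx), (fps_shift iz c gz).
rewrite -[y]expr1 -!fps_divXn.
- by rewrite -addrA -fps_resD -fps_resD.
- move=> m mz /=; case: ltnP => [_|my] /=; first by rewrite if_same.
  by case: leqP => // mx /=; apply: f0 => //; apply/eqP; rewrite -leqn0.
- by move=> m mx /=; rewrite leqNgt mx.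
- by move=> m my /=; rewrite ltnNge -ltnS my.
Qed.

Lemma box_coef a c u v w m :
  m iy = 0%N -> (m ix < a)%N -> (m iz < c)%N ->
  fcoef (y * u + x ^+ a * v + z ^+ c * w) m = 0.
Proof.
by move=> my mx mz; rewrite !fcoefD fcoefXM !fcoefXnM my mx mz !addr0.
Qed.

(** Modulo [y] and [z] only a series in [x] survives; it is zero or, with [d] its order, a unit
    times [x^d]. *)
Lemma normal_form f : exists b r, f = y * b + z * r \/
  exists d u u', u' * u = 1 /\ f = y * b + z * r + u * x ^+ d.
Proof.
set fy := fps_res (fun m => (0 < m iy)%N) f.
set g := fps_res (predC (fun m => (0 < m iy)%N)) f.
set gz := fps_res (fun m => (0 < m iz)%N) g.
set h := fps_res (predC (fun m => (0 < m iz)%N)) g.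
have fE : f = y * fps_shift iy 1 fy + z * fps_shift iz 1 gz + h.
  rewrite -[y]expr1 -[z]expr1 -!fps_divXn.
  - by rewrite -addrA -!fps_resD.
  - by move=> m mz /=; rewrite ltnNge -ltnS mz.
  - by move=> m my /=; rewrite ltnNge -ltnS my.
have hE m : fcoef h m = if (m iy == 0%N) && (m iz == 0%N) then fcoef f m else 0.
  by rewrite /= !lt0n !negbK; case: (m iy == _); case: (m iz == _).
exists (fps_shift iy 1 fy), (fps_shift iz 1 gz).
have [h0|] := pselect (forall d, fcoef h (U_(ix) *+ d)%MM = 0).
  left; rewrite {1}fE; apply: (etrans _ (addr0 _)); congr (_ + _).
  apply/fpsP => m; case: (boolP ((m iy == 0%N) && (m iz == 0%N))) =>
      [/andP[/eqP my /eqP mz]|mm].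
    rewrite -[RHS](h0 (m ix)); congr fcoef; apply/mnmP.
    by apply: ord3P; rewrite mulmnE mnm1E ?eqxx ?ord3_neq ?mul1n.
  by rewrite hE (negbTE mm).
move=> /existsNP[d0 /eqP hd0].
case: (@ex_minnP (fun d => fcoef h (U_(ix) *+ d)%MM != 0)); first by exists d0.
move=> d hd dmin; right.
have [u' u'E] : exists u', u' * fps_shift ix d h = 1.
  by apply: fps_inv_ex; rewrite /fps_shift /= add0m.
exists d, (fps_shift ix d h), u'; split=> //.
rewrite [_ * x ^+ d]mulrC -fps_divXn // => m mx.
rewrite hE; case: ifP => // /andP[/eqP my /eqP mz].
have mE : m = (U_(ix) *+ m ix)%MM.
  by apply/mnmP; apply: ord3P; rewrite mulmnE mnm1E ?eqxx ?ord3_neq ?mul1n.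
apply/eqP; case: (eqVneq (fcoef f m) 0) => // fm.
have := dmin (m ix); rewrite -mE hE my mz eqxx fm => /(_ isT).
by rewrite leqNgt mx.
Qed.

End ThreeVariables.

(** * The ascending chain condition *)

(** The least [d] occurring for any [k] already occurs at some [K], and upward closure gives all
    larger ones at [K]. *)
Lemma chain_stable2 (Q : nat -> nat -> Prop) :
  (forall k d, Q k d -> Q k.+1 d) -> (forall k d, Q k d -> Q k d.+1) ->
  exists K, forall k d, Q k d -> Q K d.
Proof.
move=> Qk Qd; have Qd' k d d' : (d <= d')%N -> Q k d -> Q k d'.
  by move=> /subnK <-; elim: (_ - _)%N => // j IH /IH; apply: Qd.
have [[d0 [k0 Q0]]|nQ] := pselect (exists d k, Q k d); last first.
  by exists 0%N => k d Qkd; case: nQ; exists d, k.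
case: (@ex_minnP (fun d => `[< exists k, Q k d >])).
  by exists d0; apply/asboolP; exists k0.
move=> d /asboolP[K QK] dmin; exists K => k d' Qkd'.
by apply: Qd' QK; apply: dmin; apply/asboolP; exists k.
Qed.

(** A form of Dickson's lemma for an increasing family of up-sets of pairs [(n, d)]. The least [d]
    anywhere, [D], is attained in some row [N]; this settles all rows from [N] on, and
    [chain_stable2] settles each of the finitely many rows below. *)
Lemma chain_stable3 (P : nat -> nat -> nat -> Prop) :
  (forall k n d, P k n d -> P k.+1 n d) -> (forall k n d, P k n d -> P k n.+1 d) ->
  (forall k n d, P k n d -> P k n d.+1) ->
  exists K N D, (forall k n d, P k n d -> P K n d) /\
    (forall k n d, P k n d -> P K N D /\ (D <= d)%N).
Proof.
move=> Pk Pn Pd.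
have Pk' k k' n d : (k <= k')%N -> P k n d -> P k' n d.
  by move=> /subnK <-; elim: (_ - _)%N => // j IH /IH; apply: Pk.
have Pn' k n n' d : (n <= n')%N -> P k n d -> P k n' d.
  by move=> /subnK <-; elim: (_ - _)%N => // j IH /IH; apply: Pn.
have Pd' k n d d' : (d <= d')%N -> P k n d -> P k n d'.
  by move=> /subnK <-; elim: (_ - _)%N => // j IH /IH; apply: Pd.
have [[d0 [k0 [n0 P0]]]|nP] := pselect (exists d k n, P k n d); last first.
  by exists 0%N, 0%N, 0%N; split=> k n d Pknd; case: nP; exists d, k, n.
case: (@ex_minnP (fun d => `[< exists k n, P k n d >])).
  by exists d0; apply/asboolP; exists k0, n0.
move=> D /asboolP[K0 [N PD]] Dmin {d0 k0 n0 P0}.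
have {}Dmin k n d : P k n d -> (D <= d)%N.
  by move=> Pknd; apply: Dmin; apply/asboolP; exists k, n.
have [K1 PK1] : exists K, forall k n d, (n < N)%N -> P k n d -> P K n d.
  elim: (N) => [|M [K1 IH]]; first by exists 0%N.
  have [K2 PK2] := chain_stable2 (fun k => Pk k M) (fun k => Pd k M).
  exists (maxn K1 K2) => k n d; rewrite ltnS leq_eqVlt => /predU1P[->|lt_nM] Pknd.
    by apply: Pk' (leq_maxr _ _) _; apply: PK2 Pknd.
  by apply: Pk' (leq_maxl _ _) _; apply: IH Pknd.
exists (maxn K0 K1), N, D; split=> k n d Pknd; last first.
  by split; [apply: Pk' (leq_maxl _ _) PD | apply: Dmin Pknd].
have [lt_nN|le_Nn] := ltnP n N.
  by apply: Pk' (leq_maxr _ _) _; apply: PK1 Pknd.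
by apply: Pk' (leq_maxl _ _) _; apply: Pn' le_Nn _; apply: Pd' (Dmin _ _ _ Pknd) PD.
Qed.

Section ChainCondition.
Variable K : fieldType.
Local Notation R := (Rxyz K).
Local Notation x := (xR K).
Local Notation y := (yR K).
Local Notation z := (zR K).

(* K[[x,z]] is Noetherian: an ideal is controlled by the exponents [d] of the
   leading terms [z ^+ n * x ^+ d] (lowest power of z, then of x) it contains. *)
Lemma ideal_chain_stable (J : nat -> R -> Prop) :
  (forall k, J k y) -> (forall k f g, J k f -> J k g -> J k (f + g)) ->
  (forall k a f, J k f -> J k (a * f)) -> (forall k f, J k f -> J k.+1 f) ->
  exists M, forall k f, J k f -> J M f.
Proof.
move=> Jy JD JM JS.
have JB k f g : J k f -> J k g -> J k (f - g).
  by move=> Jf Jg; apply: JD => //; rewrite -mulN1r; apply: JM.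
have Jle k k' f : (k <= k')%N -> J k f -> J k' f.
  by move=> /subnK <-; elim: (_ - _)%N => // j IH /IH; apply: JS.
pose P k n d := exists r, J k (z ^+ n * (x ^+ d + z * r)).
have [||| M [N [D [PM PD]]]] := @chain_stable3 P.
- by move=> k n d [r /JS]; exists r.
- by move=> k n d [r /(JM _ z)]; exists r; rewrite exprS -mulrA.
- move=> k n d [r /(JM _ x) Jr]; exists (x * r).
  by rewrite mulrCA mulrDr -exprS mulrCA in Jr.
have JyM k b : J k (y * b) by rewrite mulrC; apply: JM.
(* Multiplying by the inverse of the unit and dropping the multiple of [y] exhibits the leading term
   [z^n x^d]. *)
have lead k n f b r u u' d : u' * u = 1 -> f = y * b + z * r + u * x ^+ d ->
    J k (z ^+ n * f) -> P k n d.
  move=> u'u -> Jf; exists (u' * r).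
  have := JB _ _ _ (JM _ u' _ Jf) (JyM k (u' * z ^+ n * b)).
  have idt (A : comPzRingType) (v u0 y0 b0 w z0 r0 xd : A) : v * u0 = 1 ->
      v * (w * (y0 * b0 + z0 * r0 + u0 * xd)) - y0 * (v * w * b0) =
      w * (xd + z0 * (v * r0)).
    by move=> vu; rewrite -[in RHS](mul1r xd) -vu; ring.
  by rewrite (idt (Rxyz K)) .
exists M => k0 f0 J0; pose k := maxn k0 M.
have MLk : (M <= k)%N by apply: leq_maxr.
have {J0} : J k (z ^+ 0 * f0) by rewrite mul1r; apply: Jle J0; apply: leq_maxl.
have Jtail n f b h g : f = y * b + h + z * g -> J k (z ^+ n * h) ->
    J k (z ^+ n * f) -> J k (z ^+ n.+1 * g).
  move=> fE Jh Jf; have -> : z ^+ n.+1 * g =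
      z ^+ n * f - z ^+ n * h - y * (z ^+ n * b).
    have idt (A : comPzRingType) (y0 b0 h0 z0 g0 w : A) : z0 * w * g0 =
      w * (y0 * b0 + h0 + z0 * g0) - w * h0 - y0 * (w * b0) by ring.
    by rewrite fE exprS; apply: idt.
  by do 2!apply: (JB) => //.
(* [j] bounds the number of rows left below [N]: each step removes the leading term, if any, by
   means of an element of [J M] and passes to the factor [z ^+ n.+1]. *)
suff Q j n f : (N <= n + j)%N -> J k (z ^+ n * f) -> J M (z ^+ n * f).
  by move=> /(Q N 0%N); rewrite mul1r; apply.
elim: j n f => [|j IH] n f leN Jf; last first.
  have [b [h [g [fE Jh]]]] : exists b h g, f = y * b + h + z * g /\ J M (z ^+ n * h).
    have [b [r [fE|[d [u [u' [u'u fE]]]]]]] := normal_form f.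
      by exists b, 0, r; split; [rewrite addr0 | rewrite mulr0 -(mul0r y); apply: JM].
    have [r' Jr'] := PM _ _ _ (lead _ _ _ _ _ _ _ _ u'u fE Jf).
    exists b, (u * (x ^+ d + z * r')), (r - u * r'); split; last first.
      by rewrite mulrCA; apply: JM.
    have idt (A : comPzRingType) (c z0 r0 u0 xd r1 : A) :
      c + z0 * r0 + u0 * xd = c + u0 * (xd + z0 * r1) + z0 * (r0 - u0 * r1) by ring.
    by rewrite fE; apply: idt.
  have Jg := IH n.+1 g; rewrite addSnnS in Jg.
  have {}Jg := Jg leN (Jtail _ _ _ _ _ fE (Jle _ _ _ MLk Jh) Jf).
  rewrite fE !mulrDr [z ^+ n * (z * g)]mulrA -exprSr [z ^+ n * (y * b)]mulrCA.
  by do 2!apply: (JD) => //.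
rewrite addn0 in leN.
(* Every leading exponent is at least [D], so one element [w] with leading term [x^D] suffices for
   all rows from [N] on. If [P M N D] fails, there are no leading terms at all and [w = 0]
   serves. *)
have [w [Jw wdiv]] : exists w, J M (z ^+ N * w) /\
    forall m g, J k (z ^+ m * g) -> exists c b g', g = y * b + w * c + z * g'.
  have [[t Jt]|nP] := pselect (P M N D).
    exists (x ^+ D + z * t); split=> // m g Jg.
    have [b [r [gE|[d [u [u' [u'u gE]]]]]]] := normal_form g.
      by exists 0, b, r; rewrite mulr0 addr0.
    have [_ leDd] := PD _ _ _ (lead _ _ _ _ _ _ _ _ u'u gE Jg).
    exists (u * x ^+ (d - D)), b, (r - t * (u * x ^+ (d - D))).
    have idt (A : comPzRingType) (c z0 r0 u0 xa xD t0 : A) :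
        c + z0 * r0 + u0 * (xa * xD) =
        c + (xD + z0 * t0) * (u0 * xa) + z0 * (r0 - t0 * (u0 * xa)) by ring.
    by rewrite gE -{1}(subnK leDd) exprD; apply: idt.
  exists 0; split; first by rewrite mulr0 -(mul0r y); apply: JM.
  move=> m g Jg; have [b [r [gE|[d [u [u' [u'u gE]]]]]]] := normal_form g.
    by exists 0, b, r; rewrite mulr0 addr0.
  by have [/nP] := PD _ _ _ (lead _ _ _ _ _ _ _ _ u'u gE Jg).
pose good g := exists2 m, (N <= m)%N & J k (z ^+ m * g).
have /choice[F FE] (g : R) : exists cbg : R * R * R, good g ->
    g = y * cbg.1.2 + w * cbg.1.1 + z * cbg.2 /\ good cbg.2.
  have [[m leNm Jg]|ng] := pselect (good g); last by exists (0, 0, 0).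
  have [c [b [g' gE]]] := wdiv m g Jg; exists (c, b, g') => _; split=> //.
  exists m.+1; first exact: leqW.
  apply: Jtail gE _ Jg; rewrite -(subnK leNm) exprD [w * c]mulrC mulrACA.
  exact/JM/Jle/Jw.
(* The division by [w] need not terminate; [fps_division] sums its quotients as series in [z]. *)
pose G j := iter j (fun g => (F g).2) f.
have goodG j : good (G j).
  by elim: j => [|j /FE[]//]; exists n.
have [|c [b fE]] := @fps_division _ _ (inord 2) w y G
    (fun j => (F (G j)).1.1) (fun j => (F (G j)).1.2).
  by move=> j; have [gE _] := FE _ (goodG j); rewrite [LHS]gE [y * _ + _]addrC.
rewrite -[f]/(G 0%N) fE mulrDr [z ^+ n * (y * b)]mulrCA; apply: (JD) => //.
rewrite -(subnK leN) exprD [w * c]mulrC mulrACA; exact: JM.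
Qed.
End ChainCondition.

(** * Injective modules *)

Section Submodule.
Variables (S : nzRingType) (V : lmodType S) (P : {pred V}) (hP : submod_closed P).

(* The closure proof is an argument so that the module structure can be inferred. *)
Definition submod of submod_closed P := {v : V | v \in P}.
HB.instance Definition _ := SubChoice.on (submod hP).
HB.instance Definition _ := GRing.SubChoice_isSubLmodule.Build S V P (submod hP)
  (GRing.submod_closed_semi hP).
End Submodule.

(** [G] is the graph of a linear map from an ideal of [S] to [E]; injectivity extends it to [S], and
    [e] is the image of 1. *)
Lemma injective_module_graph (S : comNzRingType) (E : lmodType S)
    (G : S -> E -> Prop) : injective_module E -> G 0 0 ->
  (forall a s t u v, G s u -> G t v -> G (a * s + t) (a *: u + v)) ->
  (forall v, G 0 v -> v = 0) -> exists e, forall s v, G s v -> s *: e = v.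
Proof.
move=> injE G0 Glin Guniq.
pose P : {pred S^o} := fun s => `[< exists v, G s v >].
have hP : submod_closed P.
  split; first by apply/asboolP; exists 0.
  move=> a s t /asboolP[u Gu] /asboolP[v Gv]; apply/asboolP.
  by exists (a *: u + v); apply: Glin.
have Gfun s u v : G s u -> G s v -> u = v.
  move=> Gu Gv; apply/eqP; rewrite -subr_eq0; apply/eqP/Guniq.
  by have := Glin (-1) _ _ _ _ Gv Gu; rewrite mulN1r scaleN1r addNr addrC.
have /choice[g gG] (s : submod hP) : exists v, G (val s) v by apply/asboolP/(valP s).
have glin : linear g.
  move=> a s t; apply: Gfun (gG _) _.
  have -> : val (a *: s + t) = a * val s + val t by exact: linearP.
  exact: Glin.
pose glinear := GRing.isLinear.Build _ _ _ _ g glin.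
pose gl : {linear submod hP -> E} := HB.pack g glinear.
have [h hE] := injE _ S^o (val : {linear submod hP -> S^o}) gl val_inj.
exists (h 1) => s v Gsv.
have sP : s \in P by apply/asboolP; exists v.
rewrite -linearZ /= [s *: 1]mulr1 -[s]/(val (exist _ s sP : submod hP)) hE.
exact: Gfun (gG (exist _ s sP : submod hP)) Gsv.
Qed.

(** * Frobenius maps *)

Lemma scale_exp_seq (S : comNzRingType) (E : lmodType S) (t : S) (u : nat -> E) :
  (forall n, t *: u n.+1 = u n) -> forall n k, t ^+ k *: u (n + k)%N = u n.
Proof.
move=> uS n; elim=> [|k IH]; first by rewrite addn0 scale1r.
by rewrite exprSr addnS -scalerA uS.
Qed.

(** * Decomposable maps and the criterion for infinite generation *)

Section NotFinitelyGenerated.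
Variables (p : nat) (S : comNzRingType) (E : lmodType S) (X Y Z : S).
Hypotheses (p_gt1 : (1 < p)%N) (XY : X * Y = 0) (YZ : Y * Z = 0).
Hypothesis Ydiv : forall s : E, X *: s = 0 -> Y *: s = 0 -> Z *: s = 0 ->
  exists t, Y *: t = s.

(* For E = E_S this says that [phi], written as [u F^e] with [u] in
   [(I^[q] : I)] and [q = p ^ e], has no [x^q y^(q-1)] term in [u]. *)
Definition decomposable (e : nat) (phi : E -> E) := forall v : E,
  X ^+ 2 *: v = 0 -> Y *: v = 0 -> Z *: v = 0 ->
  (X * Z) ^+ (p ^ e).-1 *: phi v = 0.

Let frob0 e (phi : E -> E) : is_frob p e phi -> phi 0 = 0.
Proof. by case=> phiB _; have := phiB 0 0; rewrite subrr => ->; rewrite subrr. Qed.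

Lemma frob_socle e (phi : E -> E) s : (0 < e)%N -> is_frob p e phi ->
  X *: s = 0 -> Y *: s = 0 -> Z *: s = 0 -> Z *: phi s = 0.
Proof.
move=> e_gt0 [_ phiZ] Xs Ys Zs; have [t <-] := Ydiv Xs Ys Zs.
rewrite phiZ -(ltn_predK (ltn_expl e p_gt1)).
by rewrite exprS !scalerA mulrA [Z * Y]mulrC YZ !mul0r scale0r.
Qed.

Lemma decomposable_comp e1 e2 (phi1 phi2 : E -> E) : (0 < e1)%N -> (0 < e2)%N ->
  is_frob p e1 phi1 -> is_frob p e2 phi2 ->
  decomposable (e1 + e2) (phi1 \o phi2).
Proof.
move=> e1_gt0 e2_gt0 frob1 frob2 v X2v Yv Zv /=.
have [_ phi1Z] := frob1; have [_ phi2Z] := frob2.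
set q1 := (p ^ e1)%N; set q2 := (p ^ e2)%N; set w := phi2 v.
have q1_gt1 : (1 < q1)%N by rewrite -(expn0 p) ltn_exp2l.
have q2_gt1 : (1 < q2)%N by rewrite -(expn0 p) ltn_exp2l.
(* With this splitting [(X * Z) ^+ q2.-1] moves inside [phi1], where it sends [w] into the socle, so
   that [frob_socle] applies to [phi1]. *)
have -> : (p ^ (e1 + e2)).-1 = (q1.-1 + q2.-1 * q1)%N by rewrite expnD; nia.
rewrite exprD -scalerA exprM -phi1Z.
have Zw : Z ^+ q2 *: w = 0 by rewrite -phi2Z Zv (frob0 frob2).
have XZw : (Z * X ^+ q2) *: w = 0.
  rewrite -scalerA -phi2Z; apply: frob_socle frob2 _ _ _ => //.
  - by rewrite scalerA.
  - by rewrite scalerA mulrC XY scale0r.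
  - by rewrite scalerA mulrC -scalerA Zv scaler0.
(* Since [q2.-1 > 0], there is a factor [X] to annihilate [Y]; since [q1.-1 > 0], there is a factor
   [Z] to kill [phi1] of a socle element. *)
have [k1 q1E] : exists k, q1 = k.+2 by exists q1.-2; lia.
have [k2 q2E] : exists k, q2 = k.+2 by exists q2.-2; lia.
rewrite q1E q2E /= in Zw XZw *; set s := phi1 _.
have -> : (X * Z) ^+ k1.+1 = (X * Z) ^+ k1 * X * Z by rewrite ?exprMn ?exprS; ring.
rewrite -scalerA (frob_socle e1_gt0 frob1) ?scaler0 // scalerA.
- have -> : X * (X * Z) ^+ k2.+1 = Z ^+ k2 * (Z * X ^+ k2.+2) by rewrite ?exprMn ?exprS; ring.
  by rewrite -scalerA XZw scaler0.
- by rewrite exprS !mulrA [Y * X]mulrC XY !mul0r scale0r.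
- have -> : Z * (X * Z) ^+ k2.+1 = X ^+ k2.+1 * Z ^+ k2.+2 by rewrite ?exprMn ?exprS; ring.
  by rewrite -scalerA Zw scaler0.
Qed.

Lemma decomposable_frob0l e (phi h : E -> E) : is_frob p 0 h -> decomposable e phi ->
  decomposable e (h \o phi).
Proof.
move=> frobh dphi v X2v Yv Zv /=; have [_ hZ] := frobh.
by have := hZ ((X * Z) ^+ (p ^ e).-1) (phi v); rewrite dphi // (frob0 frobh).
Qed.

Lemma decomposable_frob0r e (phi h : E -> E) : is_frob p 0 h -> decomposable e phi ->
  decomposable e (phi \o h).
Proof.
move=> frobh dphi v X2v Yv Zv /=; have [_ hZ] := frobh.
have hZ1 s u : s *: h u = h (s *: u) by rewrite hZ expr1.
by apply: dphi; rewrite hZ1 ?X2v ?Yv ?Zv (frob0 frobh).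
Qed.

Lemma not_frob_fingen :
  (forall e, (0 < e)%N -> exists2 phi : E -> E, is_frob p e phi & ~ decomposable e phi) ->
  ~ frob_fingen p E.
Proof.
move=> exphi [T genT].
have [d d_gt0 Td] : exists2 d, (0 < d)%N &
    forall f, f \in T -> forall e, (d <= e)%N -> forall v, fhom f e v = 0.
  elim: T {genT} => [|f T [d d_gt0 Td]]; first by exists 1%N.
  have [d' fd'] := fhom_fin f; exists (maxn d d'); first by rewrite leq_max d_gt0.
  move=> g; rewrite inE => gT e; rewrite geq_max => /andP[le_de le_d'e] v.
  by case/predU1P: gT => [->|gT]; [apply: fd' | apply: Td].
(* Only degrees from [d] on are restricted, and there the generators vanish; as [d > 0], degree-zero
   elements belong to [A] too. *)
pose A : {pred frobAlg p E} :=
  fun f => `[< forall e, (d <= e)%N -> decomposable e (fhom f e) >].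
have [phi phiP phi_nd] := exphi d d_gt0.
pose phis e v : E := if e == d then phi v else 0.
have phisP e : is_frob p e (phis e).
  rewrite /phis; case: eqP => [->//|_].
  by split=> [x y|s x]; rewrite ?subr0 ?scaler0.
have phis_fin : exists d', forall e, (d' <= e)%N -> forall v, phis e v = 0.
  by exists d.+1 => e lt_de v; rewrite /phis gtn_eqF.
have : FrobAlg phisP phis_fin \in A.
  apply: genT; last first.
  - move=> f fT; apply/asboolP => e le_de v _ _ _.
    by rewrite (Td f) ?scaler0.
  - move=> f /asboolP f0; apply/asboolP => e le_de v _ _ _.
    by rewrite f0 ?scaler0 // (leq_trans d_gt0).
  split.
  - apply/asboolP => e le_de v _ _ _ /=.
    by rewrite gtn_eqF ?scaler0 // (leq_trans d_gt0).
  - move=> f g /asboolP fA /asboolP gA; apply/asboolP => e le_de v X2v Yv Zv.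
    by rewrite /= scalerBr fA ?gA ?subr0.
  - move=> f g /asboolP fA /asboolP gA; apply/asboolP => e le_de v X2v Yv Zv.
    (* The end terms [k = 0] and [k = e] inherit decomposability from one factor; all other terms
       are composites of positive degrees. *)
    rewrite /= scaler_sumr big1 // => -[k lt_ke] _ /=.
    have [->|k_gt0] := posnP k.
      by rewrite subn0; apply: decomposable_frob0l (fhomP f 0) (gA _ _) _ _ _ _.
    have [->|ne_ke] := eqVneq k e.
      by rewrite subnn; apply: decomposable_frob0r (fhomP g 0) (fA _ _) _ _ _ _.
    have lt_ke' : (k < e)%N by rewrite ltn_neqAle ne_ke.
    rewrite -{1}(subnKC (ltnW lt_ke')).
    by apply: decomposable_comp => //; rewrite ?subn_gt0 //; apply: fhomP.
by move=> /asboolP/(_ d (leqnn d)); rewrite /= /phis eqxx.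
Qed.

End NotFinitelyGenerated.

(** * A Frobenius map built from the sequence [u] *)

Section FrobeniusMap.
Variables (p : nat) (S : comNzRingType) (E : lmodType S) (X Y Z : S).
Variables (hp : p \in [pchar S]) (u : nat -> E).
Hypotheses (XY : X * Y = 0).
Hypotheses (uS : forall n, (X * Z) *: u n.+1 = u n) (Yu : forall n, Y *: u n = 0).
Hypotheses (Xu : forall n, X ^+ n.+1 *: u n = 0).
Hypotheses (Zu : forall n, Z ^+ n.+1 *: u n = 0).
Hypothesis annu : forall n s, s *: u n = 0 ->
  exists a b c, s = Y * a + X ^+ n.+1 * b + Z ^+ n.+1 * c.
Hypothesis genu : forall v, Y *: v = 0 -> exists n s, v = s *: u n.
Variable e : nat.
Local Notation q := (p ^ e)%N.

Let q_gt0 : (0 < q)%N.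
Proof. by rewrite expn_gt0 (prime_gt0 (pcharf_prime hp)). Qed.

Let qD (a b : S) : (a + b) ^+ q = a ^+ q + b ^+ q.
Proof. by apply: exprDn_pchar; rewrite pnatX pnatE ?hp // (pcharf_prime hp). Qed.

(** At index [(q * n.+1).-1] the annihilating powers of [X] and [Z] have exponent [q * n.+1], so the
    [q]-th powers of the relations on [u n] hold there. A relation is used because [n] and [s] are
    not determined by [v]. *)
Definition frob_graph (v w : E) :=
  exists n s, v = s *: u n /\ w = s ^+ q *: u (q * n.+1).-1.

(** Allows two representations, at indices [n] and [m], to be compared at the common index
    [n + m]. *)
Let lift n k s : s *: u n = (s * (X * Z) ^+ k) *: u (n + k) /\
  s ^+ q *: u (q * n.+1).-1 =
  (s * (X * Z) ^+ k) ^+ q *: u (q * (n + k).+1).-1.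
Proof.
split; first by rewrite -scalerA (scale_exp_seq uS).
have -> : (q * (n + k).+1).-1 = ((q * n.+1).-1 + k * q)%N.
  by move: q_gt0; move: (q) => Q; nia.
by rewrite exprMn -scalerA -exprM (scale_exp_seq uS).
Qed.

(** At a common index the two coefficients differ by an element of [(Y, X^(n+1), Z^(n+1))]; in
    characteristic [p] its [q]-th power lies in [(Y^q, X^(q(n+1)), Z^(q(n+1)))], which kills the
    target. *)
Lemma frob_graph_fun v w w' : frob_graph v w -> frob_graph v w' -> w = w'.
Proof.
move=> [n [s [-> ->]]] [m [t [+ ->]]].
have [-> ->] := lift n m s; have [-> ->] := lift m n t.
rewrite [(m + n)%N]addnC; move: (s * _) (t * _) (n + m)%N => {n m}s {}t n.
move=> /eqP; rewrite -subr_eq0 -scalerBl => /eqP /annu[a [b [c stE]]].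
have Wq0 (W : S) : (forall k, W ^+ k.+1 *: u k = 0) ->
    (W ^+ n.+1) ^+ q *: u (q * n.+1).-1 = 0.
  move=> W0; rewrite -exprM mulnC.
  have /prednK {1}<- : (0 < q * n.+1)%N by rewrite muln_gt0 q_gt0.
  exact: W0.
have Yq0 k : Y ^+ q *: u k = 0.
  by rewrite -(prednK q_gt0) exprSr -scalerA Yu scaler0.
rewrite -[s](subrK t) stE !qD !exprMn [Y ^+ q * _]mulrC.
rewrite ![(_ ^+ n.+1) ^+ q * _]mulrC !scalerDl -!scalerA Yq0 !Wq0 //.
by rewrite !scaler0 !add0r.
Qed.

Lemma frob_graphZ a v w : frob_graph v w -> frob_graph (a *: v) (a ^+ q *: w).
Proof. by move=> [n [s [-> ->]]]; exists n, (a * s); rewrite exprMn !scalerA. Qed.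

Lemma frob_graphB v w v' w' : frob_graph v w -> frob_graph v' w' ->
  frob_graph (v - v') (w - w').
Proof.
move=> [n [s [-> ->]]] [m [t [-> ->]]].
have [-> ->] := lift n m s; have [-> ->] := lift m n t.
rewrite [(m + n)%N]addnC; move: (s * _) (t * _) => {}s {}t.
exists (n + m)%N, (s - t); rewrite scalerBl; split=> //.
apply/eqP; rewrite subr_eq -scalerDl -qD subrK; exact/eqP.
Qed.

(* In terms of inverse monomials this map sends [x^-a z^-c] to
   [x^-(qa-1) z^-(qc+q-1)] for [a > 0]. *)
Lemma frob_map_exists : exists2 phi : E -> E, is_frob p e phi &
  phi (Z *: u 1) = u q.-1.
Proof.
(* Since [XY = 0], multiplication by [X] lands in the elements killed by [Y], so [phi] is defined on
   all of [E]. *)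
have /choice[phi phiP] (v : E) : exists w, frob_graph (X *: v) w.
  have YXv : Y *: (X *: v) = 0 by rewrite scalerA mulrC XY scale0r.
  by have [n [s ->]] := genu YXv; eexists; exists n, s.
exists phi; first split.
- move=> v w; apply: frob_graph_fun (phiP _) _.
  by rewrite scalerBr; apply: frob_graphB.
- move=> s v; apply: frob_graph_fun (phiP _) _.
  by rewrite scalerA mulrC -scalerA; apply: frob_graphZ.
- apply: frob_graph_fun (phiP _) _; exists 0%N, 1.
  by rewrite expr1n !scale1r muln1 scalerA uS.
Qed.

End FrobeniusMap.

(** * The injective hull of the residue field *)

Section Hull.
Variables (K : fieldType) (E : lmodType (Sxyz K)) (i : {linear kS K -> E}).
Hypothesis hE : injective_hull i.
Local Notation S := (Sxyz K).
Local Notation x := (xR K).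
Local Notation y := (yR K).
Local Notation z := (zR K).
Local Notation "[ 'S' f ]" := (\pi_(Sxyz K)%qT f) (format "[ 'S'  f ]").
Local Notation X := [S x].
Local Notation Y := [S y].
Local Notation Z := [S z].
Local Notation ix := (inord 0 : 'I_3).
Local Notation iy := (inord 1 : 'I_3).
Local Notation iz := (inord 2 : 'I_3).

Lemma Sxyz_ex (s : S) : exists f, s = [S f].
Proof. by exists (repr s); rewrite reprK. Qed.

Lemma Sxyz_eq0 f : [S f] = 0 <-> exists a b, f = y * (a * x + b * z).
Proof.
have yE a b : a * (x * y) + b * (y * z) = y * (a * x + b * z).
  by rewrite mulrDr [a * _]mulrA [a * x * y]mulrC [b * _]mulrCA.
split=> [f0|[a [b fE]]].
  have : f - 0 \in @Ixyz K by rewrite Quotient.idealrBE f0 rmorph0.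
  by rewrite subr0 => /asboolP[a [b ->]]; exists a, b.
apply/eqP; rewrite -(rmorph0 (\pi_S%qT)) -Quotient.idealrBE subr0.
by apply/asboolP; exists a, b; rewrite yE.
Qed.

Lemma XY0 : X * Y = 0.
Proof.
by rewrite -rmorphM; apply/Sxyz_eq0; exists 1, 0; rewrite mul1r mul0r addr0 mulrC.
Qed.

Lemma YZ0 : Y * Z = 0.
Proof. by rewrite -rmorphM; apply/Sxyz_eq0; exists 0, 1; rewrite mul0r add0r mul1r. Qed.

Lemma kS_scale0 f (m : kS K) : fcoef f 0%MM = 0 -> [S f] *: m = 0.
Proof.
move=> f0; have fm : [S f] \in @mS K by rewrite Sxyz_nonunitE f0.
rewrite /GRing.scale /= /quot_scale.
suff -> : \pi_(kS K)%qT [S f] = 0 by rewrite mul0r.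
by apply/eqP; rewrite -(rmorph0 (\pi_(kS K)%qT)) -Quotient.idealrBE subr0.
Qed.

Lemma fpsX_coef0 (j : 'I_3) : fcoef (fpsX K j) 0%MM = 0.
Proof. by rewrite /= eq_sym mnm1_eq0. Qed.

Lemma socle_scale0 f (v : E) : fcoef f 0%MM = 0 ->
  X *: v = 0 -> Y *: v = 0 -> Z *: v = 0 -> [S f] *: v = 0.
Proof.
move=> f0 Xv Yv Zv.
have [m my mx mz|a [b [c ->]]] := @box_decomp K 1 1 f.
  suff -> : m = 0%MM by [].
  apply/mnmP; apply: ord3P; rewrite mnm0E //; first by case: (m ix) mx.
  by case: (m iz) mz.
rewrite !expr1 2!rmorphD 3!rmorphM !scalerDl (mulrC Y) (mulrC X) (mulrC Z) -!scalerA.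
by rewrite Xv Yv Zv !scaler0 !addr0.
Qed.

(** * Socle and torsion of the injective hull *)

Local Notation sigma := (i 1).

Lemma sigma_neq0 : sigma != 0.
Proof.
case: hE => inji _ _; apply/eqP; rewrite -(linear0 i) => /inji/eqP.
by rewrite oner_eq0.
Qed.

Lemma sigma_scale0 f : fcoef f 0%MM = 0 -> [S f] *: sigma = 0.
Proof. by move=> f0; rewrite -linearZ kS_scale0 ?linear0. Qed.

Lemma essential_cyclic (v : E) : v != 0 ->
  exists s (m : kS K), s *: v = i m /\ i m != 0.
Proof.
case: hE => _ essi _ v0.
pose N : {pred E} := fun w => `[< exists s, w = s *: v >].
have [||m /asboolP[s sE] m0] := essi N; last by exists s, m.
- split; first by apply/asboolP; exists 0; rewrite scale0r.
  move=> a u w /asboolP[s ->] /asboolP[t ->]; apply/asboolP.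
  by exists (a * s + t); rewrite scalerDl scalerA.
- by exists v => //; apply/asboolP; exists 1; rewrite scale1r.
Qed.

(** By essentiality some multiple of [v] is a nonzero element of the residue field; the scalar must
    be a unit, since nonunits kill [v], and can be inverted. *)
Lemma socle_gen (v : E) : X *: v = 0 -> Y *: v = 0 -> Z *: v = 0 ->
  exists s, v = s *: sigma.
Proof.
move=> Xv Yv Zv; have [->|v0] := eqVneq v 0; first by exists 0; rewrite scale0r.
have [s [m [sE m0]]] := essential_cyclic v0.
have [f fE] := Sxyz_ex s; rewrite {}fE in sE.
have [f0|f0] := eqVneq (fcoef f 0%MM) 0.
  by move: m0; rewrite -sE (socle_scale0 f0) ?eqxx.
have [g gf] := fps_inv_ex f0.
have mE : i m = repr m *: sigma.
  by rewrite -linearZ; congr (i _); rewrite /GRing.scale /= /quot_scale mulr1 reprK.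
by exists ([S g] * repr m); rewrite -scalerA -mE -sE scalerA -rmorphM gf rmorph1 scale1r.
Qed.

(** The annihilators of the [f^n v] form a chain of ideals containing [y], stable from some [M]. If
    [f^M v] were nonzero, some [g] would send it to a nonzero element of the residue field; then [g]
    kills [f^(M+1) v], hence already [f^M v], a contradiction. *)
Lemma torsion f (v : E) : fcoef f 0%MM = 0 -> Y *: v = 0 ->
  exists n, [S f] ^+ n *: v = 0.
Proof.
move=> f0 Yv; pose J n g := [S g] *: ([S f] ^+ n *: v) = 0.
have [|||| M JM] := @ideal_chain_stable K J.
- by move=> n; rewrite /J scalerA mulrC -scalerA Yv scaler0.
- by move=> n g h; rewrite /J rmorphD scalerDl => -> ->; rewrite addr0.
- by move=> n a g; rewrite /J rmorphM -scalerA => ->; rewrite scaler0.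
- by move=> n g Jg; rewrite /J exprS -scalerA scalerA mulrC -scalerA Jg scaler0.
exists M; apply/eqP/negPn/negP => /essential_cyclic[s [m [sE /eqP[]]]].
have [g gE] := Sxyz_ex s; rewrite -sE gE; apply: (JM M.+1).
rewrite /J exprS -scalerA scalerA mulrC -scalerA -gE sE -linearZ.
by rewrite kS_scale0 ?linear0.
Qed.

Lemma socle_Ydiv (s : E) : X *: s = 0 -> Y *: s = 0 -> Z *: s = 0 ->
  exists t, Y *: t = s.
Proof.
move=> Xs Ys Zs; case: hE => _ _ injE.
(* This is a function of [a]: [Y * r = 0] forces [r] into [(X, Z)], which kills [s]. *)
pose G (a : S) (v : E) := exists r, a = Y * r /\ v = r *: s.
have [||| t tG] := @injective_module_graph S E G injE; last first.
- by exists t; apply: tG; exists 1; rewrite mulr1 scale1r.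
- move=> v [r [+ ->]]; have [f ->] := Sxyz_ex r.
  rewrite -rmorphM => /esym/Sxyz_eq0[a [b]].
  rewrite -[y]expr1 => /fpsXn_lreg ->.
  by rewrite rmorphD !rmorphM scalerDl -!scalerA Xs Zs !scaler0 addr0.
- move=> a b c u v [r [-> ->]] [r' [-> ->]]; exists (a * r + r').
  by rewrite mulrDr mulrCA scalerDl scalerA.
- by exists 0; rewrite mulr0 scale0r.
Qed.

(** A scalar acts on such a [v] through its coefficients in the box of monomials [x^a z^c] with
    [a, c <= n]. *)
Definition box_elt n (v : E) :=
  [/\ Y *: v = 0, X ^+ n.+1 *: v = 0 & Z ^+ n.+1 *: v = 0].

Lemma box_pi a c f g h : [S (y * f + x ^+ a * g + z ^+ c * h)] =
  Y * [S f] + X ^+ a * [S g] + Z ^+ c * [S h].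
Proof. by rewrite 2!rmorphD 3!rmorphM !rmorphXn. Qed.

Lemma box_scale0 n (f : Rxyz K) (v : E) : box_elt n v ->
  (forall m : 'X_{1..3}, m iy = 0%N -> (m ix < n.+1)%N -> (m iz < n.+1)%N -> fcoef f m = 0) ->
  [S f] *: v = 0.
Proof.
case=> Yv Xv Zv /box_decomp[a [b [c ->]]].
rewrite box_pi !scalerDl !(mulrC Y) !(mulrC (X ^+ _)).
by rewrite !(mulrC (Z ^+ _)) -!scalerA Yv Xv Zv !scaler0 !addr0.
Qed.

(** Injectivity extends the map on [(XZ, Y, X^(n+2), Z^(n+2))] that sends [XZ] to [v] and the other
    generators to 0; [w] is the image of 1. *)
Lemma box_elt_next n (v : E) : box_elt n v ->
  exists2 w, (X * Z) *: w = v & box_elt n.+1 w.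
Proof.
move=> vbox; case: hE => _ _ injE.
pose G (a : S) (w : E) := exists r b c d,
  a = X * Z * r + (Y * b + X ^+ n.+2 * c + Z ^+ n.+2 * d) /\ w = r *: v.
have [||| w wG] := @injective_module_graph S E G injE; last first.
- exists w; first by apply: wG; exists 1, 0, 0, 0; rewrite !mulr0 mulr1 !addr0 scale1r.
  split; apply: wG.
  + by exists 0, 1, 0, 0; rewrite !mulr0 mulr1 !addr0 add0r scale0r.
  + by exists 0, 0, 1, 0; rewrite !mulr0 mulr1 !addr0 !add0r scale0r.
  + by exists 0, 0, 0, 1; rewrite !mulr0 mulr1 !addr0 !add0r scale0r.
- move=> w [r [b [c [d [+ ->]]]]].
  have [f ->] := Sxyz_ex r; have [b' ->] := Sxyz_ex b.
  have [c' ->] := Sxyz_ex c; have [d' ->] := Sxyz_ex d.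
  pose F := x * z * f + (y * b' + x ^+ n.+2 * c' + z ^+ n.+2 * d').
  rewrite (_ : _ + _ = [S F]); last 
    by rewrite -box_pi -2!rmorphM -rmorphD.
  move=> /esym/Sxyz_eq0[a [a' fE]].
  apply: box_scale0 vbox _ => m my mx mz.
  (* Multiplication by [xz] moves the box monomial [m] to [m'] in the next larger box, where only
     the term [xz f] of [F] contributes. *)
  pose m' := (m + U_(ix) + U_(iz))%MM.
  have : fcoef F m' = fcoef (y * (a * x + a' * z)) m' by rewrite fE.
  have m'y : m' iy = 0%N by rewrite !mnmDE !mnm1E !ord3_neq my.
  have m'x : (m' ix < n.+2)%N.
    by rewrite !mnmDE !mnm1E eqxx !ord3_neq addn0 addn1.
  have m'z : (m' iz < n.+2)%N.
    by rewrite !mnmDE !mnm1E eqxx !ord3_neq addn0 addn1.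
  rewrite /F fcoefD box_coef // addr0 -mulrA !fcoefXM m'y !mnmBE !mnmDE !mnm1E.
  rewrite !eqxx !ord3_neq !addn0 !subn0 !addn1 /=.
  by congr (_ = _); congr fcoef; apply/mnmP => j; rewrite !mnmBE !mnmDE; lia.
- move=> a s t u w [r [b [c [d [-> ->]]]]] [r' [b' [c' [d' [-> ->]]]]].
  exists (a * r + r'), (a * b + b'), (a * c + c'), (a * d + d').
  split; last by rewrite scalerDl scalerA.
  have idt (A : comPzRingType) (a0 x1 y1 x2 z2 r0 r1 b0 b1 c0 c1 d0 d1 : A) :
      a0 * (x1 * r0 + (y1 * b0 + x2 * c0 + z2 * d0)) +
      (x1 * r1 + (y1 * b1 + x2 * c1 + z2 * d1)) = x1 * (a0 * r0 + r1) +
      (y1 * (a0 * b0 + b1) + x2 * (a0 * c0 + c1) + z2 * (a0 * d0 + d1)) by ring.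
  exact: idt.
- by exists 0, 0, 0, 0; rewrite !mulr0 !addr0 scale0r.
Qed.

Lemma box_seq : exists u : nat -> E, [/\ u 0%N = sigma,
  forall n, (X * Z) *: u n.+1 = u n & forall n, box_elt n (u n)].
Proof.
have /choice[F FE] (nv : nat * E) : exists w : E, box_elt nv.1 nv.2 ->
    (X * Z) *: w = nv.2 /\ box_elt nv.1.+1 w.
  have [/box_elt_next[w]|nb] := pselect (box_elt nv.1 nv.2); first by exists w.
  by exists 0.
pose u := fix u n := if n is k.+1 then F (k, u k) else sigma.
have ubox n : box_elt n (u n).
  elim: n => [|n IH]; last by case: (FE (n, u n) IH).
  by split; rewrite ?expr1 sigma_scale0 ?fpsX_coef0.
by exists u; split=> // n; case: (FE (n, u n) (ubox n)).
Qed.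

(** * Annihilators of the [u n], and exhaustion of the elements killed by [Y] *)

Section BoxSequence.
Variable u : nat -> E.
Hypotheses (u0 : u 0%N = sigma) (uS : forall n, (X * Z) *: u n.+1 = u n).
Hypothesis ubox : forall n, box_elt n (u n).

(** By induction on the degree of [m]: multiplying by [x^a z^b] moves the coefficient [c] at [m] to
    the corner [x^n z^n], which sends [u n] to [sigma], whence [c *: sigma = 0]. *)
Lemma box_seq_ann n s : s *: u n = 0 ->
  exists a b c, s = Y * a + X ^+ n.+1 * b + Z ^+ n.+1 * c.
Proof.
have [f ->] := Sxyz_ex s => fu.
suff /box_decomp[a [b [c ->]]] : forall m : 'X_{1..3}, m iy = 0%N ->
    (m ix < n.+1)%N -> (m iz < n.+1)%N -> fcoef f m = 0.
  by exists [S a], [S b], [S c]; rewrite box_pi.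
move=> m; have [d] := ubnP (mdeg m); elim: d m => // d IH m lt_md my mx mz.
set c := fcoef f m; pose a := (n - m ix)%N; pose b := (n - m iz)%N.
have mx_n : (m ix + a = n)%N by rewrite subnKC.
have mz_n : (m iz + b = n)%N by rewrite subnKC.
pose C : Rxyz K := fpsC 3 c.
(* At any box monomial other than the corner, the shifted series has a coefficient of [f] of degree
   below [mdeg m], zero by induction, or no term at all. *)
have : [S (x ^+ a * (z ^+ b * f) - C * (x ^+ n * (z ^+ n * 1)))] *: u n = 0.
  apply: (box_scale0 (ubox n)) => m' m'y m'x m'z.
  rewrite fcoefD fcoefN fps_mulCE !fcoefXnM fcoef1.
  set m1 := (m' - _ - _)%MM; set m2 := (m' - _ - _)%MM.
  have mz1 k : (m' - U_(ix) *+ k)%MM iz = m' iz.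
    by rewrite mnmBE mulmnE mnm1E ord3_neq subn0.
  have mE k l : ((m' - U_(ix) *+ k - U_(iz) *+ l)%MM ix = m' ix - k)%N *
       ((m' - U_(ix) *+ k - U_(iz) *+ l)%MM iz = m' iz - l)%N *
       ((m' - U_(ix) *+ k - U_(iz) *+ l)%MM iy = 0%N).
    by rewrite !mnmBE !mulmnE !mnm1E !eqxx m'y !ord3_neq !subn0 !mul1n.
  rewrite !mz1.
  have [lt_xa|le_ax] := ltnP (m' ix) a.
    by rewrite (leq_trans lt_xa) ?mulr0 ?subr0 // -mx_n leq_addl.
  have [lt_zb|le_bz] := ltnP (m' iz) b.
    by rewrite (leq_trans lt_zb) ?if_same ?mulr0 ?subr0 // -mz_n leq_addl.
  have [[m'xE m'zE]|m'n] := pselect (m' ix = n /\ m' iz = n).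
    have -> : m1 = m by apply/mnmP; apply: ord3P; rewrite /m1 ?mE ?my //; lia.
    have -> : m2 = 0%MM by apply/mnmP; apply: ord3P; rewrite /m2 ?mE ?mnm0E //; lia.
    by rewrite m'xE m'zE ltnn eqxx mulr1 subrr.
  have -> : fcoef f m1 = 0.
    have m1E : (m1 ix = m' ix - a)%N /\ (m1 iz = m' iz - b)%N /\ m1 iy = 0%N.
      by rewrite /m1 !mE.
    have mdeg3 (k : 'X_{1..3}) : mdeg k = (k ix + k iy + k iz)%N.
      rewrite mdegE !big_ord_recl big_ord0 addn0 addnA.
      by do ![congr addn]; congr (k _); apply: val_inj; rewrite /= inordK.
    by apply: IH; move: lt_md; rewrite ?mdeg3; lia.
  rewrite sub0r; apply/eqP; rewrite oppr_eq0; apply/eqP.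
  case: ltnP => [_|le_nx]; first by rewrite mulr0.
  case: ltnP => [_|le_nz]; first by rewrite mulr0.
  by case: m'n; split; lia.
rewrite rmorphB 5!rmorphM scalerBl mulrA -scalerA fu scaler0 sub0r.
rewrite !rmorphXn rmorph1 mulr1 -exprMn.
rewrite -scalerA -{2}(add0n n) (scale_exp_seq uS) u0 => /eqP; rewrite oppr_eq0 => /eqP csigma.
apply/eqP/negPn/negP => c_neq0.
have [|g gc] := @fps_inv_ex 3 K (fpsC 3 c); first by rewrite /= eqxx.
have gC : [S g] * [S C] = 1 by rewrite -rmorphM gc rmorph1.
have /eqP := sigma_neq0; apply.
by rewrite -[sigma]scale1r -gC -scalerA csigma scaler0.
Qed.

(** Induction on [a]: divide [X v] by [X] inside the multiples of [u n] and subtract; the rest is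
    killed by [X]. That case, [gen1], is the same induction on [c] with [Z], ending in the socle,
    generated by [sigma = (XZ)^n u n]. *)
Lemma box_seq_gen n a c (v : E) : (a <= n.+1)%N -> (c <= n.+1)%N ->
  X ^+ a *: v = 0 -> Z ^+ c *: v = 0 -> Y *: v = 0 ->
  exists s, v = (s * X ^+ (n.+1 - a) * Z ^+ (n.+1 - c)) *: u n.
Proof.
have [Yu Xu Zu] := ubox n.
have idt (A : comPzRingType) (t s x0 z0 r : A) :
  t * x0 * z0 - s * x0 * r * z0 = (t - s * r) * x0 * z0 by ring.
have kill (t r s : S) : t *: u n = 0 -> r = s * t -> r *: u n = 0.
  by move=> tu ->; rewrite -scalerA tu scaler0.
have gen1 c' (w : E) : (c' <= n.+1)%N -> X *: w = 0 -> Z ^+ c' *: w = 0 ->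
    Y *: w = 0 -> exists s, w = (s * X ^+ n * Z ^+ (n.+1 - c')) *: u n.
  elim: c' w => [|c' IH] w le_cn Xw Zw Yw.
    by exists 0; rewrite !mul0r scale0r -[w]scale1r.
  have [||||s Zs] := IH (Z *: w); rewrite ?(ltnW le_cn) //.
  - by rewrite scalerA mulrC -scalerA Xw scaler0.
  - by rewrite scalerA -exprSr.
  - by rewrite scalerA mulrC -scalerA Yw scaler0.
  rewrite subSS; rewrite subSn // in Zs.
  pose w' := w - (s * X ^+ n * Z ^+ (n - c')) *: u n.
  have [|||t tE] := @socle_gen w'; rewrite ?scalerBr ?Xw ?Yw ?Zs ?sub0r ?scalerA.
  - apply/eqP; rewrite oppr_eq0; apply/eqP/(kill _ _ (s * Z ^+ (n - c')) Xu).
    by rewrite exprS; ring.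
  - apply/eqP; rewrite oppr_eq0; apply/eqP/(kill _ _ (s * X ^+ n * Z ^+ (n - c')) Yu).
    by rewrite mulrC.
  - by apply/eqP; rewrite subr_eq0; apply/eqP; congr (_ *: _); rewrite exprS; ring.
  exists (s + t * Z ^+ c'); rewrite -[w](subrK ((s * X ^+ n * Z ^+ (n - c')) *: u n)).
  rewrite -/w' tE -u0 -(scale_exp_seq uS 0 n) add0n scalerA -scalerDl; congr (_ *: _).
  have Zn : Z ^+ n = Z ^+ c' * Z ^+ (n - c') by rewrite -exprD subnKC.
  by rewrite exprMn Zn; ring.
elim: a v => [|a IH] v le_an le_cn Xv Zv Yv.
  by exists 0; rewrite !mul0r scale0r -[v]scale1r.
have [|||||s Xs] := IH (X *: v); rewrite ?(ltnW le_an) //.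
- by rewrite scalerA -exprSr.
- by rewrite scalerA mulrC -scalerA Zv scaler0.
- by rewrite scalerA mulrC -scalerA Yv scaler0.
rewrite subSS; rewrite subSn // in Xs.
pose w := v - (s * X ^+ (n - a) * Z ^+ (n.+1 - c)) *: u n.
have [||||t tE] := gen1 c w; rewrite ?scalerBr ?Xs ?Yv ?Zv ?sub0r ?scalerA //.
- by apply/eqP; rewrite subr_eq0; apply/eqP; congr (_ *: _); rewrite exprS; ring.
- apply/eqP; rewrite oppr_eq0; apply/eqP/(kill _ _ (s * X ^+ (n - a)) Zu).
  have -> : Z ^+ n.+1 = Z ^+ c * Z ^+ (n.+1 - c) by rewrite -exprD subnKC.
  by ring.
- apply/eqP; rewrite oppr_eq0; apply/eqP.
  by apply: (kill _ _ (s * X ^+ (n - a) * Z ^+ (n.+1 - c)) Yu); rewrite mulrC.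
exists (s + t * X ^+ a).
rewrite -[v](subrK ((s * X ^+ (n - a) * Z ^+ (n.+1 - c)) *: u n)).
rewrite -/w tE -scalerDl; congr (_ *: _).
by have -> : X ^+ n = X ^+ a * X ^+ (n - a); [rewrite -exprD subnKC | ring].
Qed.

Lemma box_seq_exhaust (v : E) : Y *: v = 0 -> exists n s, v = s *: u n.
Proof.
move=> Yv; have [a Xa] := torsion (fpsX_coef0 ix) Yv.
have [c Zc] := torsion (fpsX_coef0 iz) Yv.
exists (a + c)%N; have [||s ->] := box_seq_gen (n := a + c) _ _ Xa Zc Yv.
- by rewrite leqW ?leq_addr.
- by rewrite leqW ?leq_addl.
by eexists; reflexivity.
Qed.
End BoxSequence.
End Hull.

Lemma Sxyz_pchar (K : fieldType) p : p \in [pchar K] -> p \in [pchar (Sxyz K)].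
Proof.
case/andP => p_pr /eqP pK; apply/andP; split=> //.
have natE k (m : 'X_{1..3}) : fcoef (k%:R : Rxyz K) m = fcoef (1 : Rxyz K) m *+ k.
  by elim: k => [|k IH]; rewrite ?mulr0n // mulrS fcoefD IH mulrS.
have p0 : p%:R = 0 :> Rxyz K.
  by apply/fpsP => m; rewrite natE -mulr_natr pK mulr0.
by rewrite -(rmorph_nat \pi_(Sxyz K)%qT) p0 rmorph0.
Qed.

Theorem theorem2p3 (K : fieldType) (p : nat) (hp : p \in [pchar K])
    (E : lmodType (Sxyz K)) (i : {linear kS K -> E}) (hE : injective_hull i) :
  ~ frob_fingen p E.
Proof.
have p_pr := pcharf_prime hp.
have [u [u0 uS ubox]] := box_seq hE.
apply: (not_frob_fingen (prime_gt1 p_pr) (XY0 K) (YZ0 K) (socle_Ydiv hE)).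
move=> e e_gt0.
have Yu n : \pi_(Sxyz K)%qT (yR K) *: u n = 0 by case: (ubox n).
have Xu n : \pi_(Sxyz K)%qT (xR K) ^+ n.+1 *: u n = 0 by case: (ubox n).
have Zu n : \pi_(Sxyz K)%qT (zR K) ^+ n.+1 *: u n = 0 by case: (ubox n).
have [phi phiP phi1] := frob_map_exists (Sxyz_pchar hp) (XY0 K) uS Yu Xu Zu
  (box_seq_ann hE u0 uS ubox) (box_seq_exhaust hE u0 uS ubox) e.
(* On [Z *: u 1] decomposability would give [(XZ)^(q-1) u_(q-1) = 0], but this element is
   [u 0 = sigma]. *)
exists phi => // /(_ (\pi_(Sxyz K)%qT (zR K) *: u 1%N)).
rewrite phi1 => phi0; have /eqP := sigma_neq0 hE; apply.
rewrite -u0 -(scale_exp_seq uS 0 (p ^ e).-1) add0n phi0 //.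
- by rewrite scalerA mulrC -scalerA Xu scaler0.
- by rewrite scalerA mulrC -scalerA Yu scaler0.
- by rewrite scalerA -expr2 Zu.
Qed.
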